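(* Let $G$ be a group given by a consistent polycyclic presentation on generators $g_1,\ldots,g_n$ with associated non-negative integers $r_1,\ldots,r_n$. Let $U\le G$ be a subgroup, let $u_1,\ldots,u_m$ be an igs for $U$, let $D=\{d(u_i)\mid 1\le i\le m\}$ and let $\overline{D}=\{1,\ldots,n\}\setminus D$. Then: (a) $|U| = r(u_1)\cdots r(u_m)$. (b) $[G:U] = l(u_1)\cdots l(u_m)\cdot\prod_{d\in\overline{D}} r_d$. Here a factor $r_d$ with $r_d=0$ in (b) is read as $\infty$, and a product with an infinite factor is infinite.
   Context: **Consistent polycyclic presentation.** $G$ has generators $g_1,\ldots,g_n$, non-negative integers $r_1,\ldots,r_n$ and defining relations $g_i g_j = g_j g_{j+1}^{a_{i,j,j+1}}\cdots g_n^{a_{i,j,n}}$ for $1\le j<i\le n$; $g_i g_j^{-1} = g_j^{-1} g_{j+1}^{b_{i,j,j+1}}\cdots g_n^{b_{i,j,n}}$ for $1\le j<i\le n$ with $r_j=0$; $g_i^{r_i} = g_{i+1}^{c_{i,i+1}}\cdots g_n^{c_{i,n}}$ for $1\le i\le n$ with $r_i>0$; where $a_{i,j,k},b_{i,j,k},c_{i,k}$ are integers lying in $\{0,\ldots,r_k-1\}$ if $r_k>0$. Moreover every $g\in G$ has a unique expression (normal form) $g=g_1^{e_1}\cdots g_n^{e_n}$ with $(e_1,\ldots,e_n)\in\mathbb{Z}^n$ and $0\le e_k<r_k$ whenever $r_k>0$. Put $G_i=\langle g_i,\ldots,g_n\rangle$ for $1\le i\le n$ and $G_{n+1}=1$;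 then $G_{i+1}\unlhd G_i$ and $G_i/G_{i+1}$ is cyclic, of order $r_i$ if $r_i>0$ and infinite if $r_i=0$. **Depth, leading exponent, relative order.** For $g\ne 1$ with normal form $g_1^{e_1}\cdots g_n^{e_n}$: the depth $d(g)$ is the $d$ with $e_1=\cdots=e_{d-1}=0$, $e_d\neq 0$; the leading exponent is $l(g)=e_d$; the relative order $r(g)$ is the order (possibly $\infty$) of $gG_{d+1}$ in $G_d/G_{d+1}$, where $d=d(g)$. **Igs.** A generating list $u_1,\ldots,u_m$ of a subgroup $U\le G$ is an igs for $U$ if the series $U_i=\langle u_i,\ldots,u_m\rangle$, $1\le i\le m$, coincides with the series $G_i\cap U$, $1\le i\le n$, with duplicates removed (both series being understood to end in the trivial subgroup, $U_{m+1}=G_{n+1}\cap U=1$).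
   Formalization: The product formula in (b) is proved only when every leading exponent l(u_i) is positive and divides r_d at its depth d (no divisibility condition if r_d=0); it fails otherwise, e.g. u_1=g_1^4 in the cyclic group of order 6. Part (a) and the case r_d=0 for some d outside D hold for every igs. *)

(* Defs.v *)
From mathcomp Require Import all_boot all_order all_algebra.
From mathcomp Require Import finmap.
From mathcomp Require Import all_classical all_reals.
Set Implicit Arguments.
Unset Strict Implicit.
Unset Printing Implicit Defensive.
Import Order.TTheory GRing.Theory Num.Theory.
Local Open Scope classical_set_scope.
Local Open Scope ring_scope.

(* Indices are 0-based: the generators g_1, ..., g_n are indexed by 'I_n.     *)
(* Orders and indices of groups live in [\bar int], with +oo for infinite.    *)

Definition zexpg (G : groupType) (x : G) (z : int) : G :=
  match z with Posz k => (x ^+ k)%g | Negz k => (x ^- k.+1)%g end.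

Definition subgroup (G : groupType) (U : set G) : Prop := group_closed [in U].

Definition gen (G : groupType) (A : set G) : set G := smallest (@subgroup G) A.

Definition xcard (T : choiceType) (A : set T) : \bar int :=
  if `[< finite_set A >] then (#|` fset_set A|%:Z)%:E else +oo%E.

Definition lcosets (G : groupType) (U : set G) : set (set G) :=
  [set [set (x * y)%g | y in U] | x in [set: G]].

Definition sg_index (G : groupType) (U : set G) : \bar int := xcard (lcosets U).

(* The order of the coset x N in a quotient by the normal subgroup N; the     *)
(* identity (x N) ^+ k = N is spelled out as x ^+ k \in N.                    *)
Definition coset_order (G : groupType) (N : set G) (x : G) : \bar int :=
  if pselect (exists k : nat, (0 < k)%N && ((x ^+ k)%g \in N)) is left ex
  then ((ex_minn ex)%:Z)%:E else +oo%E.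

(* Only the entries pc_a i j k with j < i and j < k, pc_b i j k with j < i,   *)
(* j < k and pc_r j = 0, and pc_c i k with i < k and 0 < pc_r i are relevant. *)
Record pcdata (n : nat) := PcData {
  pc_r : 'I_n -> nat;
  pc_a : 'I_n -> 'I_n -> 'I_n -> int;
  pc_b : 'I_n -> 'I_n -> 'I_n -> int;
  pc_c : 'I_n -> 'I_n -> int }.

Section Pc.
Variables (n : nat) (P : pcdata n).
Local Notation r := (pc_r P).

Definition reduced_exp (k : 'I_n) (e : int) : Prop :=
  (0 < r k)%N -> 0 <= e < (r k)%:Z.

Definition pc_wf : Prop :=
  [/\ forall i j k : 'I_n, (j < i)%N -> (j < k)%N -> reduced_exp k (pc_a P i j k),
      forall i j k : 'I_n, (j < i)%N -> (j < k)%N -> r j = 0%N ->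
        reduced_exp k (pc_b P i j k)
    & forall i k : 'I_n, (i < k)%N -> (0 < r i)%N -> reduced_exp k (pc_c P i k)].

(* \prod is order-sensitive here: the factors appear by increasing k. *)
Definition pc_relations (H : groupType) (h : 'I_n -> H) : Prop :=
  [/\ forall i j : 'I_n, (j < i)%N ->
        (h i * h j = h j * \prod_(k < n | (j < k)%N) zexpg (h k) (pc_a P i j k))%g,
      forall i j : 'I_n, (j < i)%N -> r j = 0%N ->
        (h i * (h j)^-1 =
         (h j)^-1 * \prod_(k < n | (j < k)%N) zexpg (h k) (pc_b P i j k))%g
    & forall i : 'I_n, (0 < r i)%N ->
        (h i ^+ r i = \prod_(k < n | (i < k)%N) zexpg (h k) (pc_c P i k))%g].

(* The relations are defining (von Dyck): any family of elements of a group   *)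
(* satisfying them is the image of the generators under a homomorphism.       *)
Definition pc_presents (G : groupType) (g : 'I_n -> G) : Prop :=
  [/\ gen (range g) = [set: G],
      pc_relations g
    & forall (H : groupType) (h : 'I_n -> H), pc_relations h ->
        exists f : {multiplicative G -> H}, forall i, f (g i) = h i].

Section Elements.
Variables (G : groupType) (g : 'I_n -> G).

Definition normal_form (x : G) (e : {ffun 'I_n -> int}) : Prop :=
  (forall k, reduced_exp k (e k)) /\ x = (\prod_(k < n) zexpg (g k) (e k))%g.

Definition consistent_pcp : Prop :=
  [/\ pc_wf, pc_presents g & forall x : G, exists! e, normal_form x e].

Definition tail_subgroup (i : nat) : set G :=
  gen [set g k | k in [set k : 'I_n | (i <= k)%N]].

Definition nf_exp (x : G) : {ffun 'I_n -> int} :=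
  xget [ffun=> 0] [set e | normal_form x e].

Definition depth (x : G) : option 'I_n :=
  [pick d : 'I_n | (nf_exp x d != 0) &&
     [forall k : 'I_n, (k < d)%N ==> (nf_exp x k == 0)]].

(* The values below at x = 1, where depth x = None, are irrelevant. *)
Definition lead_exp (x : G) : int :=
  if depth x is Some d then nf_exp x d else 0.

Definition rel_order (x : G) : \bar int :=
  if depth x is Some d then coset_order (tail_subgroup d.+1) x else 1%E.

(* [undup] keeps one copy of each term; equal terms of the descending series  *)
(* are consecutive, so which copy is kept does not matter. As the right-hand  *)
(* side has no repetition, the members of an igs are nontrivial.              *)
Definition igs (U : set G) (u : seq G) : Prop :=
  gen [set` u] = U /\
  [seq gen [set` drop i u] | i <- iota 0 (size u).+1] =
  undup [seq tail_subgroup i `&` U | i <- iota 0 n.+1].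

Definition depths (u : seq G) : seq 'I_n := pmap depth u.

(* Leading exponents are positive and divide r_d at their depth d (no         *)
(* condition besides positivity if r_d = 0). The index formula needs this:    *)
(* in the cyclic group of order 6 = r_1 the list [:: g_1 ^+ 4] is an igs of a *)
(* subgroup of index 2, but its leading exponent is 4; and in the infinite    *)
(* cyclic group [:: g_1^-1] is an igs of the whole group, with leading        *)
(* exponent -1.                                                               *)
Definition normed (u : seq G) : Prop :=
  forall x, x \in u -> 0 < lead_exp x /\
    forall d, depth x = Some d -> (lead_exp x %| (r d)%:Z)%Z.

End Elements.

Definition xr (d : 'I_n) : \bar int :=
  if r d == 0%N then +oo%E else ((r d)%:Z)%:E.

End Pc.

(* Main.v *)
(* Along the series G_j, from the bottom up, one maintains transversals of 1 in
   G_j ∩ U and of G_j ∩ U in G_j. At each step either G_j ∩ U does not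
   grow, and the powers of g_j below r_j multiply the second transversal, or the
   next member x of the igs, of depth j, generates G_j ∩ U over
   G_(j+1) ∩ U: its powers multiply the first transversal, and the powers of
   g_j below gcd(l(x), r_j) multiply the second, since the image of U in
   G_j / G_(j+1) is generated by g_j ^ l(x). *)
Require Import Defs.
From mathcomp Require Import all_boot all_order all_algebra.
From mathcomp Require Import finmap.
From mathcomp Require Import all_classical all_reals.
From mathcomp Require Import zify ring.
Set Implicit Arguments.
Unset Strict Implicit.
Unset Printing Implicit Defensive.
Import Order.TTheory GRing.Theory Num.Theory.
Local Open Scope classical_set_scope.
Local Open Scope ring_scope.

(** * Integer powers in a group *)

Section IntegerPowers.
Variable G : groupType.
Implicit Types (x y : G) (m n : int).

Lemma zexpg1 x : zexpg x 1 = x. Proof. by []. Qed.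

Lemma zexpgN x n : zexpg x (- n) = (zexpg x n)^-1%g.
Proof.
case: n => [[|k]|k]; rewrite ?invg1 //.
by rewrite NegzE opprK /= invgK.
Qed.

Lemma zexpgS x n : zexpg x (n + 1) = (zexpg x n * x)%g.
Proof.
case: n => [k|[|k]].
- by rewrite -PoszD addn1 /= expgSr.
- by rewrite /= expg1 mulVg.
have -> : Negz k.+1 + 1 = Negz k by rewrite !NegzE; lia.
by rewrite /= [in RHS]expgS invgM mulgVK.
Qed.

Lemma zexpgD x m n : zexpg x (m + n) = (zexpg x m * zexpg x n)%g.
Proof.
elim/int_ind: n => [|k IH|k IH]; first by rewrite addr0 mulg1.
  by rewrite -addn1 PoszD addrA !zexpgS IH mulgA.
(* For the downward step, [zexpgS] at both exponents turns the induction hypothesis into the claim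
   multiplied by [x], which cancels. *)
have := zexpgS x (m - k.+1%:Z); have := zexpgS x (- k.+1%:Z).
have -> : - k.+1%:Z + 1 = - k%:Z by lia.
have -> : m - k.+1%:Z + 1 = m - k%:Z by lia.
by rewrite {}IH => -> /eqP; rewrite mulgA => /eqP /(mulIg x) ->.
Qed.

Lemma zexpgM x m n : zexpg x (m * n) = zexpg (zexpg x m) n.
Proof.
elim/int_ind: n => [|k IH|k IH]; first by rewrite mulr0.
  by rewrite -addn1 PoszD mulrDr mulr1 [LHS]zexpgD IH zexpgS.
by rewrite -addn1 PoszD opprD mulrDr !zexpgD IH mulrN1 (zexpgN x m).
Qed.

End IntegerPowers.

(** * Subgroups, generation, and extension of a normalised subgroup by one element *)

Section Subgroups.
Variable G : groupType.
Implicit Types (N S T U : set G) (a x y : G).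

Lemma subgroup1 U : subgroup U -> U 1%g.
Proof. by move=> [+ _]; rewrite inE. Qed.

Lemma subgroupM U x y : subgroup U -> U x -> U y -> U (x * y)%g.
Proof. by move=> /group_closedM UM xU yU; rewrite -in_setE UM ?in_setE. Qed.

Lemma subgroupV U x : subgroup U -> U x -> U x^-1%g.
Proof. by move=> /group_closedV UV xU; rewrite -in_setE UV ?in_setE. Qed.

Lemma subgroupMr U x y : subgroup U -> U y -> U (x * y)%g <-> U x.
Proof.
move=> sU yU; split=> [xyU|xU]; last exact: subgroupM.
by rewrite -[x](mulgK y); apply: subgroupM => //; apply: subgroupV.
Qed.

Lemma subgroupMl U x y : subgroup U -> U x -> U (x * y)%g <-> U y.
Proof.
move=> sU xU; split=> [xyU|yU]; last exact: subgroupM.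
by rewrite -[y](mulKg x); apply: subgroupM => //; apply: subgroupV.
Qed.

Lemma subgroup_zexpg U x n : subgroup U -> U x -> U (zexpg x n).
Proof.
move=> sU xU; have UX k : U (x ^+ k)%g.
  by elim: k => [|k IH]; [exact: subgroup1 | rewrite expgS; exact: subgroupM].
by case: n => k //=; apply: subgroupV.
Qed.

Lemma subgroupP U : U 1%g -> (forall x y, U x -> U y -> U (x * y)%g) ->
  (forall x, U x -> U x^-1%g) -> subgroup U.
Proof.
move=> U1 UM UV; split; first by rewrite inE.
by move=> x y; rewrite !inE => xU yU; apply: UM => //; apply: UV.
Qed.

Lemma subgroupI U S : subgroup U -> subgroup S -> subgroup (U `&` S).
Proof.
move=> sU sS; apply: subgroupP; first by split; exact: subgroup1.
  by move=> x y [xU xS] [yU yS]; split; exact: subgroupM.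
by move=> x [xU xS]; split; exact: subgroupV.
Qed.

Lemma subgroup_gen A : subgroup (gen A : set G).
Proof.
apply: subgroupP => [V [sV _]|x y xA yA V VA|x xA V VA]; first exact: subgroup1.
  by apply: (subgroupM VA.1); [exact: xA | exact: yA].
by apply: (subgroupV VA.1); exact: xA.
Qed.

Lemma sub_gen (A : set G) : A `<=` gen A.
Proof. exact: sub_gen_smallest. Qed.

Lemma gen_sub (A U : set G) : subgroup U -> A `<=` U -> gen A `<=` U.
Proof. exact: smallest_sub. Qed.

Lemma gen_set0 : gen (set0 : set G) = [set 1%g].
Proof.
apply/seteqP; split=> [|_ ->]; last by apply: subgroup1; exact: subgroup_gen.
apply: gen_sub; last by [].
apply: subgroupP => [//|_ _ -> ->|_ ->] /=; first by rewrite mulg1.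
by rewrite invg1.
Qed.

(** Conjugation by [b] is a homomorphism, so the preimage of [N] is a subgroup and only generators
    need to be tested. *)
Lemma gen_conj (N A : set G) b : subgroup N ->
  (forall x, A x -> N (b^-1 * x * b)%g) -> forall y, gen A y -> N (b^-1 * y * b)%g.
Proof.
move=> sN AN; apply: gen_sub => //; apply: subgroupP => [|x y xN yN|x xN].
- by rewrite mulg1 mulVg; exact: subgroup1.
- have -> : (b^-1 * (x * y) * b = b^-1 * x * b * (b^-1 * y * b))%g.
    by rewrite !mulgA mulgK.
  exact: (subgroupM sN).
- have -> : (b^-1 * x^-1 * b = (b^-1 * x * b)^-1)%g by rewrite !invgM invgK mulgA.
  exact: (subgroupV sN).
Qed.

(** All integer powers are included because conjugation by [a] alone may map [N] onto a proper
    subgroup of itself. *)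
Definition normalises a N := forall z y, N y -> N (zexpg a (- z) * y * zexpg a z)%g.

Lemma normalisesP a N : (forall y, N y -> N (a^-1 * y * a)%g) ->
  (forall y, N y -> N (a * y * a^-1)%g) -> normalises a N.
Proof.
move=> Na NaV; elim/int_ind => [|k IH|k IH] y yN.
- by rewrite oppr0 mul1g mulg1.
- rewrite -addn1 PoszD opprD addrC !zexpgD zexpg1 -!mulgA [(_ * (_ * a))%g]mulgA.
  by rewrite !mulgA -(mulgA a^-1)%g -(mulgA a^-1)%g; apply: Na; apply: IH.
- rewrite -addn1 PoszD opprD [- (_ - 1)]opprD !opprK [_ + 1]addrC.
  rewrite !zexpgD -!mulgA.
  have -> : (zexpg a 1 * (zexpg a k * (y * (zexpg a (- k%:Z) * zexpg a (-1)))))%g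
    = (a * (zexpg a (- - k%:Z) * y * zexpg a (- k%:Z)) * a^-1)%g.
    by rewrite opprK !mulgA.
  by apply: NaV; apply: IH.
Qed.

Lemma normalises_conj x (N H : set G) : subgroup H -> H x ->
  (forall h y, H h -> N y -> N (h^-1 * y * h)%g) -> normalises x N.
Proof.
move=> sH xH NH; apply: normalisesP => y yN; first exact: NH.
by rewrite -{1}[x]invgK; apply: NH => //; exact: subgroupV.
Qed.

Definition cyclic_ext a N : set G := [set h | exists z y, N y /\ h = (zexpg a z * y)%g].

Section Degree.
Variables (N : set G) (a : G).
Hypotheses (sN : subgroup N) (aN : normalises a N).

(* h lies in the coset a ^ z N; for N normalised by a of finite index in
   <a, N>, the degree z is only determined modulo that index. *)
Definition deg h z := N (zexpg a (- z) * h)%g.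

Lemma degP h z : deg h z <-> exists2 y, N y & h = (zexpg a z * y)%g.
Proof.
split=> [hz|[y yN ->]]; last by rewrite /deg zexpgN mulKg.
by exists (zexpg a (- z) * h)%g => //; rewrite zexpgN mulVKg.
Qed.

Lemma deg0 h : deg h 0 <-> N h.
Proof. by rewrite /deg oppr0 mul1g. Qed.

Lemma degX z : deg (zexpg a z) z.
Proof. by rewrite /deg zexpgN mulVg; apply: subgroup1. Qed.

(** Moving a power of [a] past an element of [N] only conjugates that element, so degrees add as
    under a homomorphism to the quotient by [N]. *)
Lemma degM h1 h2 z1 z2 : deg h1 z1 -> deg h2 z2 -> deg (h1 * h2)%g (z1 + z2).
Proof.
rewrite /deg => h1z h2z.
have -> : (zexpg a (- (z1 + z2)) * (h1 * h2) =
  (zexpg a (- z2) * (zexpg a (- z1) * h1) * zexpg a z2) * (zexpg a (- z2) * h2))%g.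
  by rewrite opprD addrC zexpgD !zexpgN !mulgA mulgK.
by apply: subgroupM => //; apply: aN.
Qed.

Lemma degV h z : deg h z -> deg h^-1%g (- z).
Proof.
rewrite /deg => /(subgroupV sN) /(aN (- z)).
by rewrite invgM !zexpgN !invgK mulgA mulgK.
Qed.

Lemma deg_zexpg h z k : deg h z -> deg (zexpg h k) (z * k).
Proof.
move=> hz; elim/int_ind: k => [|k IH|k IH].
- by rewrite mulr0; apply/deg0; exact: subgroup1.
- by rewrite -addn1 PoszD mulrDr mulr1 zexpgS; apply: degM.
- rewrite -addn1 PoszD opprD mulrDr mulrN1 zexpgD (zexpgN h 1); apply: degM => //.
  exact: degV.
Qed.

Lemma cyclic_extP h : cyclic_ext a N h <-> exists z, deg h z.
Proof.
split=> [[z [y [yN ->]]]|[z /degP [y yN ->]]]; last by exists z, y.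
by exists z; apply/degP; exists y.
Qed.

Lemma subgroup_cyclic_ext : subgroup (cyclic_ext a N).
Proof.
apply: subgroupP => [|x y|x]; rewrite ?cyclic_extP.
- by exists 0; apply/deg0; exact: subgroup1.
- by move=> [z xz] [z' yz]; exists (z + z'); apply: degM.
- by move=> [z xz]; exists (- z); apply: degV.
Qed.

Lemma cyclic_ext_gen (A : set G) : gen A = N -> gen (a |` A) = cyclic_ext a N.
Proof.
move=> AN; apply/seteqP; split.
  apply: gen_sub => [|x]; first exact: subgroup_cyclic_ext.
  case=> [->|xA]; apply/cyclic_extP; first by exists 1; exact: (degX 1).
  by exists 0; apply/deg0; rewrite -AN; apply: sub_gen.
move=> _ [z [y [yN ->]]]; have sg := subgroup_gen (a |` A).
apply: (subgroupM sg); first by apply: (subgroup_zexpg _ sg); apply: sub_gen; left.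
by move: y yN; rewrite -AN; apply: gen_sub => // x xA; apply: sub_gen; right.
Qed.

End Degree.
End Subgroups.

(* 0 encodes the infinite order, as pc_r does. *)
Definition xord (c : int) : \bar int := if c == 0 then +oo%E else c%:E.

Lemma xord_gt0 (c : int) : 0 <= c -> (0 < xord c)%E.
Proof. by rewrite /xord le_eqVlt eq_sym; case: eqP => [->|_] //=; rewrite lte_fin. Qed.

(** Since [0 * +oo = 0], an infinite factor makes a product infinite only when the other factors are
    known to be positive. *)
Lemma prode_gt0 (R : realDomainType) (I : Type) (s : seq I) (Q : pred I) (F : I -> \bar R) :
  (forall i, Q i -> (0 < F i)%E) -> (0 < \prod_(i <- s | Q i) F i)%E.
Proof. by move=> F0; apply: (big_ind (fun x => 0 < x)%E) => // x y; exact: mule_gt0. Qed.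

(** * Cardinalities with values in the extended integers *)

Section Cardinals.

Lemma inj_infinite (T1 T2 : Type) (f : T1 -> T2) (A : set T1) (B : set T2) :
  infinite_set A -> {in A &, injective f} -> f @` A `<=` B -> infinite_set B.
Proof.
move=> Ainf fI /sub_finite_set fAB Bfin; apply: Ainf.
by rewrite -(eq_finite_set (inj_card_eq fI)); exact: fAB.
Qed.

Variables (T1 T2 T3 : choiceType).

Lemma xcard_image2 (f : T1 -> T2 -> T3) (A : set T1) (B : set T2) :
  (forall a a' b b', A a -> A a' -> B b -> B b' -> f a b = f a' b' ->
     a = a' /\ b = b') ->
  xcard [set f a b | a in A & b in B] = (xcard A * xcard B)%E.
Proof.
move=> fI; have xinf (T : choiceType) (C : set T) : infinite_set C -> xcard C = +oo%E.
  by move=> Cinf; rewrite /xcard asboolF.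
have xne (T : choiceType) (C : set T) : C !=set0 -> (0 < xcard C)%E.
  move=> [c Cc]; rewrite /xcard; case: asboolP => // Cfin.
  rewrite lte_fin ltz_nat cardfs_gt0; apply/fset0Pn; exists c.
  by rewrite in_fset_set ?inE.
have x0 (T : choiceType) : xcard (set0 : set T) = 0%E.
  by rewrite /xcard asboolT // fset_set0.
(* Empty sets are settled first: the product rule for an infinite set requires the other cardinality
   to be positive. *)
have [->|/set0P [a aA]] := eqVneq A set0.
  by rewrite [X in xcard X](_ : _ = set0) ?x0 ?mul0e // -subset0 => z [x []].
have [->|/set0P [b bB]] := eqVneq B set0.
  by rewrite [X in xcard X](_ : _ = set0) ?x0 ?mule0 // -subset0 => z [x _ []].
case: (pselect (finite_set A)) => [Afin|Ainf]; last first.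
  rewrite (xinf _ A Ainf) gt0_mulye ?xne //; last by exists b.
  apply: xinf; apply: (inj_infinite (f := f^~ b) Ainf).
    by move=> x y; rewrite !inE => xA yA /fI [].
  by move=> _ [x xA <-]; exists x => //; exists b.
case: (pselect (finite_set B)) => [Bfin|Binf]; last first.
  rewrite (xinf _ B Binf) gt0_muley ?xne //; last by exists a.
  apply: xinf; apply: (inj_infinite (f := f a) Binf).
    by move=> x y; rewrite !inE => xB yB /fI [].
  by move=> _ [x xB <-]; exists a => //; exists x.
pose s := [seq f x y | x <- fset_set A, y <- fset_set B].
have -> : [set f a b | a in A & b in B] = [set` [fset x in s]%fset].
  apply/seteqP; split=> z /=; rewrite inE.
    case=> x xA [y yB <-]; apply/allpairsP; exists (x, y).
    by rewrite /= !in_fset_set // !inE.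
  case/allpairsP=> [[x y]] /=; rewrite !in_fset_set // !inE => -[xA yB ->].
  by exists x => //; exists y.
suff su : uniq s.
  by rewrite /xcard !asboolT // set_fsetK card_fseq undup_id // size_allpairs PoszM EFinM.
apply: allpairs_uniq; rewrite ?fset_uniq // => -[x y] [x' y'].
move=> /allpairsP [[x0' y0'] /= []]; rewrite !in_fset_set // !inE => ? ? [-> ->].
move=> /allpairsP [[x1' y1'] /= []]; rewrite !in_fset_set // !inE => ? ? [-> ->].
by move=> /fI [] // -> ->.
Qed.

Lemma xcard_image (f : T1 -> T2) (A : set T1) :
  {in A &, injective f} -> xcard (f @` A) = xcard A.
Proof.
move=> fI; rewrite /xcard (eq_finite_set (inj_card_eq fI)).
case: asboolP => // Afin; rewrite fset_set_image // card_in_imfset //.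
by move=> x y /=; rewrite !in_fset_set //; exact: fI.
Qed.

End Cardinals.

Lemma xcard1 (T : choiceType) (x : T) : xcard [set x] = 1%E.
Proof. by rewrite /xcard asboolT // fset_set1 cardfs1. Qed.

(* All of Z when c = 0. *)
Definition residues (c : int) : set int := [set z | 0 < c -> 0 <= z < c].

Lemma xcard_residues (c : int) : 0 <= c -> xcard (residues c) = xord c.
Proof.
case: c => // c _; rewrite /xord; case: eqVneq => [[->]|c0].
  have -> : residues 0 = setT by apply/seteqP; split.
  rewrite /xcard asboolF //; apply: (inj_infinite infinite_nat (f := Posz)) => //.
  by move=> x y _ _ [].
have -> : residues c = [set Posz x | x in `I_c].
  apply/seteqP; split=> [z zc|_ [x /= xc <-] _]; last by lia.
  have : 0 <= z < c by apply: zc; lia.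
  by case: z {zc} => // z zc; exists z => //=; lia.
rewrite xcard_image /xcard; last by move=> x y _ _ [].
by rewrite asboolT // (card_fset_set (card_eqxx _)).
Qed.

(** The convention [z %% 0 = z] matches [residues 0] being all integers, so finite and infinite
    orders are treated alike. *)
Lemma residues_modz (c z : int) : 0 <= c -> residues c z -> (z %% c)%Z = z.
Proof.
rewrite le_eqVlt => /predU1P[<- _|c0 /(_ c0) zc]; first by rewrite modz0.
exact: modz_small.
Qed.

Lemma modz_residues (c z : int) : residues c (z %% c)%Z.
Proof. by move=> c0; rewrite modz_ge0 ?ltz_pmod // lt0r_neq0. Qed.

(** * Orders modulo a subgroup, and transversals *)

Section Orders.
Variable G : groupType.

(** The factors do not commute, so the first possibly nontrivial one is split off by induction on
    the length; [F'] is [F] with the factor at [j] replaced by 1. *)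
Lemma prod_ord_head m (j : 'I_m) (F F' : 'I_m -> G) :
  (forall k : 'I_m, (k < j)%N -> F k = 1%g) ->
  (forall k : 'I_m, (k <= j)%N -> F' k = 1%g) ->
  (forall k : 'I_m, (j < k)%N -> F k = F' k) ->
  (\prod_(k < m) F k = F j * \prod_(k < m) F' k)%g.
Proof.
elim: m j F F' => [[] //|m IH] j F F' Flt F'le FF'.
rewrite !big_ord_recl (F'le ord0) // mul1g.
case: (unliftP ord0 j) => [j' jE|jE]; rewrite jE; last first.
  by congr (_ * _)%g; apply: eq_bigr => k _; apply: FF'; rewrite jE.
rewrite (Flt ord0) ?jE // mul1g (IH j' _ (fun k => F' (lift ord0 k))) // => k kj.
- by apply: Flt; rewrite jE.
- by apply: F'le; rewrite jE.
- by apply: FF'; rewrite jE.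
Qed.

(** Encoding infinite order by [o = 0] gives one divisibility criterion for both cases, as 0 divides
    only 0. *)
Lemma coset_orderP (N : set G) (x : G) : subgroup N ->
  exists o : nat, coset_order N x = xord o /\
    forall z, N (zexpg x z) <-> (o%:Z %| z)%Z.
Proof.
move=> sN; rewrite /coset_order; case: pselect => [ex|nex].
  case: ex_minnP => o /andP [o0 /set_mem oN] omin; exists o; rewrite /xord.
  split; first by case: eqVneq o0 => // -[->].
  have Nmod z : N (zexpg x z) <-> N (zexpg x (z %% o)%Z).
    rewrite {1}(divz_eq z o) addrC mulrC zexpgD subgroupMr // zexpgM.
    exact: subgroup_zexpg.
  move=> z; rewrite Nmod; split=> [|/dvdz_mod0P ->]; last exact: subgroup1.
  have := ltz_pmod z (o0 : 0 < o%:Z); have := modz_ge0 z (lt0r_neq0 (o0 : 0 < o%:Z)).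
  move E: (z %% o)%Z => [k|] // _ ko xkN; apply/dvdz_mod0P; rewrite E.
  case: k => // k in E ko xkN *; have /omin : (0 < k.+1)%N && ((x ^+ k.+1)%g \in N).
    by rewrite /= inE.
  by move: ko; lia.
exists 0%N; split=> // z; rewrite dvd0z; split=> [zN|/eqP ->]; last exact: subgroup1.
apply/eqP; apply: contra_notP nex => /eqP z0.
(* A nonzero exponent, inverted if negative, yields a positive one, contradicting infinite order. *)
exists `|z|%N; rewrite absz_gt0 z0 inE.
by case: z zN {z0} => k //= /(subgroupV sN); rewrite invgK.
Qed.

(** The last clause says that two representatives of the same left coset of [S] coincide. For
    trivial [S] this forces [T = H], so orders and indices are computed by the same construction. *)
Definition left_transversal (H S T : set G) :=
  [/\ T `<=` H, forall h, H h -> exists t s, [/\ T t, S s & h = (t * s)%g]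
    & forall t s, T t -> S s -> T (t * s)%g -> s = 1%g].

(** Sending [x] to the coset of [x] is a bijection from [T] onto the left cosets of [S]. *)
Lemma sg_index_transversal S T : subgroup S -> left_transversal setT S T ->
  sg_index S = xcard T.
Proof.
move=> sS [_ Tex Tun]; pose f (x : G) : set G := [set (x * y)%g | y in S].
have fV x y : f x = f y -> S (x^-1 * y)%g.
  move=> fxy; have : f y y by exists 1%g; rewrite ?mulg1 //; exact: subgroup1.
  by rewrite -fxy => -[s sS' <-]; rewrite mulKg.
have -> : sg_index S = xcard (f @` T); last first.
  apply: xcard_image => x y; rewrite !inE => xT yT /fV xyS.
  have := Tun _ _ xT xyS; rewrite mulVKg => /(_ yT) e.
  by rewrite -[x]mulg1 -e mulVKg.
congr xcard; apply/seteqP; split=> _ [x xT <-]; last by exists x.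
have [t [s [tT sS' ->]]] := Tex x I; exists t => //.
apply/seteqP; split=> _ [y yS <-].
  exists (s^-1 * y)%g; last by rewrite -mulgA mulVKg.
  by apply: subgroupM => //; apply: subgroupV.
by exists (s * y)%g; [exact: subgroupM | rewrite mulgA].
Qed.

(* S meets the coset a ^ z N exactly when c = gcd(l, r) divides z, so the
   products of the a ^ z (0 <= z < c) with the members of T serve. *)
Lemma left_transversal_extension (N S T : set G) (a x : G) (r : nat) (l : int) :
  subgroup N -> subgroup S -> normalises a N ->
  (forall z, N (zexpg a z) <-> (r%:Z %| z)%Z) ->
  S x -> deg N a x l -> S `<=` cyclic_ext x (S `&` N) ->
  left_transversal N (S `&` N) T ->
  exists T', left_transversal (cyclic_ext a N) S T' /\
    xcard T' = (xord (gcdz l r) * xcard T)%E.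
Proof.
move=> sN sS aN aNr xS xl Sx [TN Tex Tun]; set c := gcdz l r.
have degu h z z' : deg N a h z -> deg N a h z' -> (r%:Z %| z - z')%Z.
  move=> /degP [y yN ->]; rewrite /deg mulgA -zexpgD => /(subgroupMr _ sN yN).1.
  by rewrite aNr addrC.
have c0 : 0 <= c by [].
(* The degree of [s] is a multiple of [l] modulo [r], hence of [c]; so [z] and [z'] agree modulo [c]
   and, being reduced, are equal. This gives both the injectivity of the product map and the
   uniqueness of representatives. *)
have key z z' t s : residues c z -> residues c z' -> T t -> S s ->
    deg N a (zexpg a z * t * s)%g z' -> z = z' /\ N s.
  move=> zc z'c tT sS' zts.
  have [k [m [[mS mN] sE]]] := Sx _ sS'.
  have sk : deg N a s (l * k).
    rewrite sE -[l * k]addr0; apply: degM => //; first exact: deg_zexpg.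
    exact/deg0.
  have zt : deg N a (zexpg a z * t)%g z.
    by apply/degP; exists t => //; exact: TN.
  have zz' : z = z'.
    apply/esym; rewrite -(residues_modz c0 zc) -(residues_modz c0 z'c).
    apply/eqP; rewrite eqz_mod_dvd.
    have /(dvdz_trans (dvdz_gcdr l r)) /dvdzP[q] := degu _ _ _ zts (degM sN aN zt sk).
    have /dvdzP[q' ->] : (c %| l * k)%Z by rewrite dvdz_mulr // dvdz_gcdl.
    by rewrite -/c => e; apply/dvdzP; exists (q + q'); lia.
  split=> //; move: zts; rewrite -zz' /deg zexpgN -!mulgA mulKg.
  by apply: (subgroupMl _ sN _).1; exact: TN.
exists [set (zexpg a z * t)%g | z in residues c & t in T]; split; last first.
  rewrite xcard_image2 ?xcard_residues // => z z' t t' zc z'c tT t'T e.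
  have [||zz' _] := key z z' t 1%g zc z'c tT; first exact: subgroup1.
    by rewrite mulg1 e; apply/degP; exists t' => //; exact: TN.
  by split=> //; move: e; rewrite zz' => /mulgI.
split=> [_ [z zc [t tT <-]]|h /cyclic_extP [w hw]|_ s [z zc [t tT <-]] sS'].
- by exists z, t; split=> //; exact: TN.
(* Write [w = q * c + z] and [c = u * l + v * r]. Removing [x] to the power [q * u] from [h] leaves
   degree [z + q * v * r], so that dividing by the [z]-th power of [a] lands in [N]. *)
- have [u [v uv]] := Bezoutz l r; rewrite -/c in uv.
  pose k := (w %/ c)%Z * u; pose z := (w %% c)%Z.
  have : N (zexpg a (- z) * h * zexpg x (- k))%g.
    suff : deg N a (zexpg a (- z) * h * zexpg x (- k))%g ((w %/ c)%Z * v * r).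
      case/degP=> y yN ->; apply: subgroupM => //; apply/aNr.
      by rewrite dvdz_mull.
    have -> : (w %/ c)%Z * v * r = - z + w + l * (- k).
      rewrite /k /z; move: (divz_eq w c); move: (w %/ c)%Z (w %% c)%Z => q z' ->.
      by rewrite -uv; ring.
    by apply: degM => //; [apply: degM => //; exact: degX | exact: deg_zexpg].
  move=> /Tex [t [m [tT [mS mN] e]]].
  exists (zexpg a z * t)%g, (m * zexpg x k)%g; split.
  + by exists z; [exact: modz_residues | exists t].
  + by apply: subgroupM => //; exact: subgroup_zexpg.
  by rewrite -!mulgA [(t * _)%g]mulgA -e !zexpgN mulgVK mulVKg.
- move=> [z' z'c [t' t'T e]].
  have [|zz' sN'] := key z z' t s zc z'c tT sS'.
    by rewrite -e; apply/degP; exists t' => //; exact: TN.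
  apply: (Tun t) => //; move: e; rewrite -zz' -mulgA => /mulgI <-; exact: t'T.
Qed.

(** The extension step with [x = 1] and [l = 0], where the gcd is [r] itself. *)
Lemma left_transversal_cyclic (N S T : set G) (a : G) (r : nat) :
  subgroup N -> subgroup S -> normalises a N ->
  (forall z, N (zexpg a z) <-> (r%:Z %| z)%Z) ->
  S `<=` N -> left_transversal N S T ->
  exists T', left_transversal (cyclic_ext a N) S T' /\
    xcard T' = (xord r * xcard T)%E.
Proof.
move=> sN sS aN aNr SN; have {1}<- : S `&` N = S by apply/setIidPl.
move=> /(left_transversal_extension (x := 1%g) (l := 0) sN sS aN aNr).
rewrite gcd0z; apply; first exact: subgroup1.
  by apply/deg0; exact: subgroup1.
move=> s sS'; exists 0, s; split; last by rewrite mul1g.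
by split=> //; exact: SN.
Qed.

End Orders.

(** * The polycyclic series and its link with normal forms *)

Section PolycyclicSeries.
Variables (n : nat) (P : pcdata n) (G : groupType) (g : 'I_n -> G).
Hypothesis cons : consistent_pcp P g.
Local Notation r := (pc_r P).
Local Notation tail := (tail_subgroup g).

Lemma subgroup_tail i : subgroup (tail i).
Proof. exact: subgroup_gen. Qed.

Lemma tail0 : tail 0 = setT.
Proof.
case: cons => _ [<- _ _] _; congr gen; apply/seteqP; split=> _ [k _ <-]; by exists k.
Qed.

Lemma tail_max : tail n = [set 1%g].
Proof.
rewrite /tail_subgroup [X in gen X](_ : _ = set0) ?gen_set0 // -subset0.
by move=> _ [k /= + _]; rewrite leqNgt ltn_ord.
Qed.

Lemma sub_tail i j : (i <= j)%N -> tail j `<=` tail i.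
Proof.
move=> ij; apply: gen_sub => [|_ [k /= jk <-]]; first exact: subgroup_tail.
by apply: sub_gen; exists k => //=; exact: leq_trans jk.
Qed.

Lemma tail_generator (k : 'I_n) i : (i <= k)%N -> tail i (g k).
Proof. by move=> ik; apply: sub_gen; exists k. Qed.

Lemma tail_prod (j : 'I_n) (e : 'I_n -> int) :
  tail j.+1 (\prod_(k < n | (j < k)%N) zexpg (g k) (e k))%g.
Proof.
have st := subgroup_tail j.+1.
apply: (big_ind (tail j.+1)); [exact: subgroup1 | by move=> x y; exact: (subgroupM st)|].
by move=> k jk; apply: (subgroup_zexpg _ st); exact: tail_generator.
Qed.

Lemma tail_pow (j : 'I_n) : tail j.+1 (zexpg (g j) (r j)).
Proof.
case: (posnP (r j)) => [->|rj0]; first exact: (subgroup1 (subgroup_tail _)).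
by case: cons => _ [_ [_ _ rel_c] _] _; rewrite /= rel_c //; exact: tail_prod.
Qed.

(** Conjugation by [g j] is controlled by the relations with exponents [pc_a]. Conjugation by its
    inverse uses those with [pc_b] if [r j = 0], and otherwise reduces to conjugation by a positive
    power. *)
Lemma normalises_tail (j : 'I_n) : normalises (g j) (tail j.+1).
Proof.
have st := subgroup_tail j.+1.
case: (cons) => _ [_ [rel_a rel_b _] _] _.
have conj1 y : tail j.+1 y -> tail j.+1 ((g j)^-1 * y * g j)%g.
  apply: gen_conj => // _ [k /= jk <-].
  by rewrite -mulgA rel_a // mulKg; exact: tail_prod.
apply: normalisesP => // y yN.
case: (posnP (r j)) => [rj0|rj_gt0].
  rewrite -{1}[g j]invgK; move: y yN; apply: gen_conj => // _ [k /= jk <-].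
  by rewrite invgK -mulgA rel_b // mulVKg; exact: tail_prod.
(* g_j^-1 = g_j ^ (r_j - 1) modulo G_(j+1) *)
have conjX m z : tail j.+1 z -> tail j.+1 ((g j ^+ m)^-1 * z * g j ^+ m)%g.
  elim: m z => [|m IH] z zN; first by rewrite expg0 invg1 mul1g mulg1.
  rewrite expgSr invgM; have := conj1 _ (IH _ zN).
  by rewrite !mulgA.
(* Conjugating [y] first by the inverse of the [r j]-th power, which lies in the tail, and then by
   the power [r j - 1] amounts to conjugating by the inverse of [g j]. *)
have := conjX (r j).-1 (zexpg (g j) (r j) * y * (zexpg (g j) (r j))^-1)%g.
rewrite [zexpg _ _](_ : _ = g j ^+ (r j).-1 * g j)%g; last by rewrite -expgSr prednK.
rewrite invgM !mulgA mulVg mul1g mulgVK; apply.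
rewrite -!mulgA -invgM mulgA -expgSr prednK // mulgA.
have pN := @tail_pow j; apply: (subgroupM st); last exact: (subgroupV st pN).
exact: (subgroupM st).
Qed.

Lemma tailE (j : 'I_n) : tail j = cyclic_ext (g j) (tail j.+1).
Proof.
rewrite -(cyclic_ext_gen (subgroup_tail _) (@normalises_tail j) erefl).
congr gen; apply/seteqP; split=> [_ [k /= jk <-]|_ [->|[k /= jk <-]]].
- move: jk; rewrite leq_eqVlt => /predU1P[/val_inj ->|jk]; first by left.
  by right; exists k.
- by exists j => /=.
- by exists k => //=; exact: ltnW.
Qed.

Lemma normal_form_cons (j : 'I_n) y e z : normal_form P g y e ->
  (forall k : 'I_n, (k <= j)%N -> e k = 0) -> residues (r j) z ->
  normal_form P g (zexpg (g j) z * y)%g [ffun k => if k == j then z else e k].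
Proof.
move=> [e_red ->] e0 zr; split=> [k|]; first by rewrite ffunE; case: eqP => // ->.
set e' := [ffun k => _].
rewrite (@prod_ord_head _ _ j (fun k => zexpg (g k) (e' k)) (fun k => zexpg (g k) (e k))).
- by rewrite ffunE eqxx.
- move=> k kj; rewrite ffunE ifN ?e0 1?ltnW //.
  by rewrite -val_eqE ltn_eqF.
- by move=> k kj; rewrite e0.
- by move=> k jk; rewrite ffunE ifN // -val_eqE gtn_eqF.
Qed.

Lemma deg_residue (j : 'I_n) x : tail j x ->
  exists2 z, residues (r j) z & deg (tail j.+1) (g j) x z.
Proof.
rewrite tailE => /cyclic_extP [z xz]; exists (z %% r j)%Z; first exact: modz_residues.
have st := subgroup_tail j.+1; rewrite /deg.
have -> : - (z %% r j)%Z = (r j)%:Z * (z %/ r j)%Z - z.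
  by rewrite [X in _ - X](divz_eq z (r j)); ring.
rewrite zexpgD zexpgM -mulgA; apply: (subgroupM st) => //.
by apply: (subgroup_zexpg _ st); exact: tail_pow.
Qed.

(** Descending induction on [i]: a reduced power of the next generator is put in front of a normal
    form from the next tail. This builds normal forms whose initial exponents visibly vanish. *)
Lemma tail_normal_form i x : (i <= n)%N -> tail i x ->
  exists2 e, normal_form P g x e & forall k : 'I_n, (k < i)%N -> e k = 0.
Proof.
elim: {i}(n - i)%N {-2}i (erefl (n - i)%N) x => [|m IH] i ni x lein.
  have -> : i = n by lia.
  rewrite tail_max => ->; exists [ffun=> 0]; last by move=> k _; rewrite ffunE.
  by split=> [k rk|]; [rewrite ffunE; lia | rewrite big1 // => k _; rewrite ffunE].
have ltin : (i < n)%N by lia.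
move=> xi; have [z zr /degP [y yN ->]] := @deg_residue (Ordinal ltin) _ xi.
have [|e ye e0] := IH i.+1 _ y ltin yN; first by lia.
exists [ffun k => if k == Ordinal ltin then z else e k]; first exact: normal_form_cons.
move=> k ki; rewrite ffunE ifN ?e0 1?ltnW //.
by rewrite -val_eqE ltn_eqF.
Qed.

Lemma deg_normal_form (j : 'I_n) x z : deg (tail j.+1) (g j) x z -> residues (r j) z ->
  exists e, [/\ normal_form P g x e, e j = z & forall k : 'I_n, (k < j)%N -> e k = 0].
Proof.
move=> /degP [y yN ->] zr; have [e ye e0] := tail_normal_form (ltn_ord j) yN.
exists [ffun k => if k == j then z else e k].
split; first exact: normal_form_cons; first by rewrite ffunE eqxx.
move=> k kj; rewrite ffunE ifN ?e0 1?ltnW //.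
by rewrite -val_eqE ltn_eqF.
Qed.

Lemma normal_form_inj x e e' : normal_form P g x e -> normal_form P g x e' -> e = e'.
Proof.
case: cons => _ _ /(_ x) [e0 [_ e0P]] /e0P <- /e0P <- //.
Qed.

(** This is where consistency fixes the relative orders: if the power lies in the next tail, its
    reduction modulo [r j] has degree 0 as well as degree [z %% r j]. The two resulting normal forms
    must coincide. *)
Lemma tail_zexpg (j : 'I_n) z : tail j.+1 (zexpg (g j) z) <-> ((r j)%:Z %| z)%Z.
Proof.
have st := subgroup_tail j.+1; split=> [zN|/dvdzP [q ->]]; last first.
  by rewrite mulrC zexpgM; apply: (subgroup_zexpg _ st); exact: tail_pow.
have d0 : deg (tail j.+1) (g j) (zexpg (g j) (z %% r j)%Z) 0.
  apply/deg0; have -> : (z %% r j)%Z = z + (r j)%:Z * - (z %/ r j)%Z.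
    by rewrite [X in X + _](divz_eq z (r j)); ring.
  rewrite zexpgD zexpgM; apply: (subgroupM st) => //.
  by apply: (subgroup_zexpg _ st); exact: tail_pow.
have [|e [xe ej _]] := deg_normal_form d0; first by move=> rj0; rewrite lexx.
have [|e' [xe' e'j _]] := deg_normal_form (degX (g j) st (z %% r j)%Z).
  exact: modz_residues.
by apply/dvdz_mod0P; rewrite -e'j -(normal_form_inj xe xe') ej.
Qed.

(** Depth and leading exponent are defined through normal forms; this translates them into
    membership in the series and degree, the only form used afterwards. *)
Lemma depth_tail (j : 'I_n) x : tail j x -> ~ tail j.+1 x ->
  depth P g x = Some j /\ deg (tail j.+1) (g j) x (lead_exp P g x).
Proof.
move=> xj xNj; have [z zr xz] := deg_residue xj.
have [e [xe ez e0]] := deg_normal_form xz zr.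
have z0 : z != 0 by apply: contra_notN xNj => /eqP z0; move: xz; rewrite z0 deg0.
have xE : nf_exp P g x = e.
  rewrite /nf_exp; case: xgetP => [e' _ xe'|/(_ e) //].
  exact: normal_form_inj xe' xe.
have dE : depth P g x = Some j.
  rewrite /depth; case: pickP => [d|/(_ j)]; rewrite xE; last first.
    rewrite ez z0 /= => /negP []; apply/forallP => k; apply/implyP => kj.
    by rewrite e0.
  case/andP=> ed0 /forallP ed; congr Some; apply/val_inj/eqP.
  case: ltngtP => // [dj|jd]; first by rewrite e0 ?eqxx in ed0.
  by have := ed j; rewrite jd ez (negPf z0).
by rewrite /lead_exp dE xE ez.
Qed.

(* The contribution of x to the index without assuming [normed]; under [normed]
   the gcd is the leading exponent. *)
Definition lead_index x : \bar int :=
  if depth P g x is Some d then xord (gcdz (lead_exp P g x) (r d)) else 1%E.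

(** Degrees add, and the conjugate has degree [- z + 0 + z = 0]. *)
Lemma normal_tail (j : 'I_n) h y : tail j h -> tail j.+1 y ->
  tail j.+1 (h^-1 * y * h)%g.
Proof.
have st := subgroup_tail j.+1; have nt := @normalises_tail j.
rewrite tailE => /cyclic_extP [z hz] yN; apply/(deg0 _ (g j)).
have -> : 0 = - z + 0 + z by rewrite addr0 addNr.
apply: (degM st nt); last exact: hz.
by apply: (degM st nt); [exact: (degV st nt) | exact/deg0].
Qed.

Lemma xrE d : xr P d = xord (r d).
Proof. by []. Qed.

(** * Induction along the series cut down to [U] *)

Variable U : set G.
Hypothesis sU : subgroup U.
Local Notation S i := (tail i `&` U).

Lemma subgroup_S i : subgroup (S i).
Proof. by apply: subgroupI => //; exact: subgroup_tail. Qed.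

(** Here [v] is the final segment of the igs that generates the part of [U] in the tail from [j].
    The bound on depths is carried along so that [j] is a new depth at each step. *)
Lemma igs_series i j v : (j + i)%N = n ->
  [seq gen [set` drop k v] | k <- iota 0 (size v).+1] =
    undup [seq S k | k <- iota j i.+1] ->
  [/\ gen [set` v] = S j,
      forall x, x \in v -> exists2 d : 'I_n, depth P g x = Some d & (j <= d)%N,
      exists T, left_transversal (S j) [set 1%g] T /\
        xcard T = (\prod_(x <- v) rel_order P g x)%E
    & exists T, left_transversal (tail j) (S j) T /\
        xcard T = ((\prod_(x <- v) lead_index x) *
          \prod_(d < n | (j <= d)%N && (d \notin depths P g v)) xr P d)%E].
Proof.
elim: i j v => [|i IH] j v jn.
  have {jn} -> : j = n by lia.
  (* The right-hand series has one term, while a nonempty [v] gives at least two. *)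
  case: v => [|x v] // _; have Sn : S n = [set 1%g].
    rewrite tail_max; apply/seteqP; split=> [x []//|_ ->].
    by split=> //; exact: subgroup1.
  have tr1 : left_transversal [set 1%g] [set 1%g : G] [set 1%g].
    split=> // h ->; exists 1%g, 1%g; split=> //; by rewrite mulg1.
  rewrite Sn tail_max set_nil gen_set0; split=> //; exists [set 1%g].
    by rewrite big_nil xcard1.
  rewrite big_nil mul1e big_pred0 ?xcard1 // => d.
  by rewrite leqNgt ltn_ord.
have jltn : (j < n)%N by lia.
pose a : 'I_n := Ordinal jltn.
have st := subgroup_tail j.+1.
have SS k l : (k <= l)%N -> S l `<=` S k.
  by move=> kl x [xl xU]; split=> //; exact: sub_tail xl.
have SI : S j `&` tail j.+1 = S j.+1.
  rewrite setIAC; congr (_ `&` _); apply/setIidPr; exact: sub_tail.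
set s := [seq S k | k <- iota j.+1 i.+1].
(* [undup] keeps the last copy, so [S j] is dropped exactly when it recurs later; as the series
   descends, it then equals [S j.+1]. *)
have -> : undup [seq S k | k <- iota j i.+2] =
  if S j \in s then undup s else S j :: undup s by [].
case: ifPn => [/mapP[k]|SNin].
  rewrite mem_iota => /andP[jk _] Sjk.
  have Sj : S j = S j.+1.
    by apply/seteqP; split; [rewrite Sjk; exact: SS | exact: SS].
  move=> /(IH j.+1 v) [|gv dv [T1 [T1S T1c]] [T2 [T2S T2c]]]; first by lia.
  split; rewrite ?Sj //.
  - by move=> x /dv [d dx jd]; exists d => //; exact: ltnW.
  - by exists T1.
  have [T [TS Tc]] := left_transversal_cyclic st (subgroup_S j.+1)
      (@normalises_tail a) (@tail_zexpg a) (@subIsetl _ _ _) T2S.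
  exists T; rewrite (tailE a) Tc T2c muleCA; split=> //; congr (_ * _)%E.
  (* No member of [v] has depth [j], so the new factor [xr P a] occurs in the product over missing
     depths. *)
  rewrite [RHS](bigD1 a) /=; last first.
    rewrite leqnn; apply/negP; rewrite /depths mem_pmap => /mapP [x xv xa].
    by have [d] := dv x xv; rewrite -xa => -[<-]; rewrite ltnn.
  congr (_ * _)%E; apply: eq_bigl => d; rewrite -val_eqE /= ltn_neqAle eq_sym.
  by rewrite -andbA andbC.
(* An empty [v] would give a series of one term, but [S j] is followed by at least one other. *)
case: v => [/(congr1 (fun t => size (behead t)))|x v].
  by move/esym/eqP; rewrite size_eq0 => /eqP/undup_nil.
rewrite -[iota 0 _]/(0%N :: iota 1 (size v).+1) map_cons drop0 (iotaDl 1 0) -map_comp.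
move=> -[gxv sE].
have [|gv dv [T1 [T1S T1c]] [T2 [T2S T2c]]] := IH j.+1 v _ sE; first by lia.
have gxvE : gen (x |` [set` v]) = S j.
  rewrite -gxv; congr gen; apply/seteqP; split=> y /=; rewrite inE.
    by case=> [->|->]; rewrite ?eqxx ?orbT.
  by case/predU1P; [left | right].
have xS : S j x by rewrite -gxvE; apply: sub_gen; left.
(* Otherwise all generators of [S j] would lie in [S j.+1], and [S j] would recur in the series. *)
have xNj : ~ tail j.+1 x.
  move=> xNj; move/negP: SNin; apply; apply/mapP; exists j.+1; first by rewrite inE eqxx.
  apply/seteqP; split; last exact: SS.
  rewrite -gxvE; apply: gen_sub; first exact: subgroup_S.
  move=> y [->|yv]; first by split=> //; case: xS.
  by rewrite -gv; exact: sub_gen.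
have [dx xdeg] := @depth_tail a x (xS.1 : tail a x) xNj.
have xnorm : normalises x (S j.+1).
  apply: (normalises_conj (subgroup_S j) xS) => h y [hj hU] [yj yU]; split.
    exact: (@normal_tail a).
  by apply: (subgroupM sU) => //; apply: (subgroupM sU) => //; exact: subgroupV.
have SE : S j = cyclic_ext x (S j.+1).
  by rewrite -gxvE (cyclic_ext_gen (subgroup_S _) xnorm gv).
split=> //.
- move=> y; rewrite inE => /predU1P [->|/dv [d dy jd]]; first by exists a.
  by exists d => //; exact: ltnW.
- have [o [oE oP]] := coset_orderP x st.
  have s1 : subgroup [set 1%g : G] by rewrite -gen_set0; exact: subgroup_gen.
  (* As [x] lies in [U], its order modulo the next tail equals its order modulo the part of that
     tail in [U]. *)
  have oS z : S j.+1 (zexpg x z) <-> (o%:Z %| z)%Z.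
    rewrite -oP; split=> [[]//|zN]; split=> //.
    by apply: (subgroup_zexpg _ sU); case: xS.
  have S1 : [set 1%g] `<=` S j.+1 by move=> _ ->; exact: (subgroup1 (subgroup_S _)).
  have [T [TS Tc]] := left_transversal_cyclic (subgroup_S j.+1) s1 xnorm oS S1 T1S.
  exists T; rewrite SE Tc T1c big_cons; split=> //.
  by rewrite /rel_order dx -oE.
- have xext : S j `<=` cyclic_ext x (S j `&` tail j.+1) by rewrite SI -SE.
  have trT2 : left_transversal (tail j.+1) (S j `&` tail j.+1) T2 by rewrite SI.
  have [T [TS Tc]] := left_transversal_extension st (subgroup_S j)
    (@normalises_tail a) (@tail_zexpg a) xS xdeg xext trT2.
  exists T; split; first by rewrite [X in left_transversal X](tailE a).
  rewrite Tc T2c big_cons muleA {2}/lead_index dx; congr (_ * _)%E.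
  (* The index [j] has become a depth, so the indices missing from [j] on are those formerly missing
     from [j.+1] on. *)
  apply: eq_bigl => d; rewrite /depths /= dx /= inE negb_or ltn_neqAle eq_sym -val_eqE.
  by rewrite andbCA andbA.
Qed.

(** A positive [l] dividing [r d] equals their gcd, also when [r d = 0]. *)
Lemma lead_index_normed u x : normed P g u -> x \in u -> depth P g x <> None ->
  lead_index x = (lead_exp P g x)%:E.
Proof.
move=> nu /nu [l0 ldvd]; rewrite /lead_index.
case dx : (depth P g x) => [d|] // _.
have /gcdz_idPl -> := ldvd d dx.
by rewrite /xord gtz0_abs // gt_eqF.
Qed.

End PolycyclicSeries.

Theorem lemma4 (n : nat) (P : pcdata n) (G : groupType) (g : 'I_n -> G)
    (U : set G) (u : seq G) :
  consistent_pcp P g -> subgroup U -> igs g U u ->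
  xcard U = (\prod_(x <- u) rel_order P g x)%E
  /\
  ((exists2 d : 'I_n, d \notin depths P g u & pc_r P d = 0%N) ->
     sg_index U = +oo%E)
  /\
  (normed P g u ->
     sg_index U = ((\prod_(x <- u) (lead_exp P g x)%:E) *
                (\prod_(d < n | d \notin depths P g u) xr P d))%E).
Proof.
move=> cons sU [_ series].
have [_ depu [T1 [[T1U T1ex _] T1c]]] := igs_series cons sU (add0n n) series.
rewrite (tail0 cons) setTI in T1U T1ex *; case=> T2 [T2S T2c].
split; [|rewrite (sg_index_transversal sU T2S) T2c; split].
(* A transversal of the trivial subgroup in [U] is [U] itself. *)
- rewrite -T1c; congr xcard; apply/seteqP; split=> // x /T1ex [t [_ [tT -> ->]]].
  by rewrite mulg1.
- case=> d du rd; rewrite [X in (_ * X)%E](bigD1 d) //= {1}/xr rd eqxx.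
  (* A zero gcd or relative order is read as [+oo], so every other factor is positive. *)
  rewrite gt0_mulye ?gt0_muley ?prode_gt0 // => [x|d'] _.
    by rewrite /lead_index; case: depth => // k; exact: xord_gt0.
  by rewrite xrE xord_gt0.
- move=> nu; congr (_ * _)%E; apply: eq_big_seq => x xu; apply: (lead_index_normed nu xu).
  by have [d ->] := depu x xu.
Qed.
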